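(* Let $K$ be a compact line. If the set of internal points of $K$ that have countable right character and do not have a separable adjacency in $K$ can be covered by countably many sets of finite two-sided height in $K$, then $K$ is separably determined.
   Context: A compact line is a totally ordered set which is compact in its order topology. A point $t\in K$ is right-isolated (resp. left-isolated) if $t=\max K$ (resp. $t=\min K$) or there is $s>t$ with $]t,s[=\emptyset$ (resp. $s<t$ with $]s,t[=\emptyset$); internal points are those neither right- nor left-isolated. For a closed subset $H$, $H^+$ is the set of right-isolated points of $H$ in its induced order. The right character of $t$ is $\omega$ if $t$ is right-isolated, and otherwise the least cardinality of a subset $A\subseteq\,]t,\max K]$ with $\inf A=t$. A point $t$ has a separable adjacency in $K$ if it belongs to a separable convex subset of $K$ with more than one point. For $A\subseteq K$, a point $t\in A$ is internal to $A$ relative to $K$ if $t\ne\min K,\max K$ and for all $s_1<t<s_2$ in $K$ both $]s_1,t[\cap A$ and $]t,s_2[\cap A$ are nonempty; $\mathrm{Der}(A,K)$ is the set of such points, $\mathrm{Der}_0(A,K)=A$, $\mathrm{Der}_{n+1}(A,K)=\mathrm{Der}(\mathrm{Der}_n(A,K),K)$, and $A$ has finite two-sided height in $K$ if $\mathrm{Der}_n(A,K)=\emptyset$ for some $n$. $\mathrm{NBV}(K)$ is the space of right-continuous real maps of bounded variation on $K$, identified with $C(K)^*$ via $F_\mu(t)=\mu([\min K,t])$; $\lim_{i\in I}a_i=0$ means $\{i:|a_i|\ge\varepsilon\}$ finite for all $\varepsilon>0$, $c_0(I)$ the set of such families; $(F_i)_{i\in I}$ is weak*-null if $\lim_i\int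 f\,d\mu_i=0$ for all $f\in C(K)$. $(F_i)$ is of type $c_0\ell_1$ over $Q$ if $F_i(t)=a_{i,t}+b_{i,t}$ with $\lim_ia_{i,t}=0$ for each $t\in Q$ and $\sup_i\sum_{t\in Q}|b_{i,t}|<\infty$. $K$ is separably determined if for every weak*-null family $(F_i)_{i\in I}$ in $\mathrm{NBV}(K)$ and every $Q\subseteq K$: whenever $\{t\in Q\cap(H\setminus H^+):(F_i(t))_{i\in I}\notin c_0(I)\}$ is countable for every closed separable $H\subseteq K$, the family is of type $c_0\ell_1$ over $Q$. *)

(* Defs.v *)
From HB Require Import structures.
From mathcomp Require Import all_boot all_order all_algebra.
From mathcomp Require Import all_classical all_reals.
From mathcomp Require Import ereal esum topology normedtype measure lebesgue_integral.
Set Implicit Arguments. Unset Strict Implicit. Unset Printing Implicit Defensive.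
Import Order.TTheory GRing.Theory Num.Theory.
Import numFieldNormedType.Exports.
Local Open Scope classical_set_scope.
Local Open Scope ring_scope.

Section CompactLines.
Context {d : Order.disp_t} (K : orderTopologicalType d).
Implicit Types (t s u : K) (A H : set K).

Definition compact_line : Prop := compact [set: K].

Definition is_maxK t : Prop := forall s, (s <= t)%O.
Definition is_minK t : Prop := forall s, (t <= s)%O.

Definition right_isolated t : Prop :=
  is_maxK t \/ exists s, (t < s)%O /\ (forall u, ~ ((t < u)%O /\ (u < s)%O)).
Definition left_isolated t : Prop :=
  is_minK t \/ exists s, (s < t)%O /\ (forall u, ~ ((s < u)%O /\ (u < t)%O)).
Definition internal t : Prop := ~ right_isolated t /\ ~ left_isolated t.

Definition plus_pts H : set K :=
  [set t | H t /\ ((forall s, H s -> (s <= t)%O) \/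
     exists s, H s /\ (t < s)%O /\ (forall u, H u -> ~ ((t < u)%O /\ (u < s)%O)))].

Definition is_inf A t : Prop :=
  (forall a, A a -> (t <= a)%O) /\
  (forall v, (forall a, A a -> (v <= a)%O) -> (v <= t)%O).

(** the right character of t is countable (i.e. <= omega):
    either t is right-isolated (character omega) or some countable
    A included in ]t, max K] has infimum t *)
Definition countable_right_char t : Prop :=
  right_isolated t \/
  exists A, countable A /\ A `<=` [set s | (t < s)%O] /\ is_inf A t.

Definition separable_set A : Prop :=
  exists D : set K, countable D /\ D `<=` A /\ A `<=` closure D.

Definition convex_set A : Prop :=
  forall x y z, A x -> A y -> (x <= z)%O -> (z <= y)%O -> A z.

Definition separable_adjacency t : Prop :=
  exists C : set K, convex_set C /\ separable_set C /\ C t /\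
    exists x y, C x /\ C y /\ x <> y.

Definition Der A : set K :=
  [set t | A t /\ ~ is_minK t /\ ~ is_maxK t /\
     forall s1 s2, (s1 < t)%O -> (t < s2)%O ->
       (exists a, A a /\ (s1 < a)%O /\ (a < t)%O) /\
       (exists a, A a /\ (t < a)%O /\ (a < s2)%O)].

Definition Der_n (n : nat) A : set K := iter n Der A.

Definition finite_two_sided_height A : Prop := exists n, Der_n n A = set0.

End CompactLines.

Definition c0fam {R : realType} {I : Type} (a : I -> R) : Prop :=
  forall eps : R, 0 < eps -> finite_set [set i | eps <= `|a i|].

(** K, pointed by some k0 : K (MathComp-Analysis measurable types are
    pointed), equipped below with its Borel sigma-algebra. *)
Definition pointedK {d} {K : orderTopologicalType d} (k0 : K) : Type := K.
Section PointedK.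
Context {d : Order.disp_t} (K : orderTopologicalType d) (k0 : K).
HB.instance Definition _ := Choice.on (pointedK k0).
HB.instance Definition _ := isPointed.Build (pointedK k0) k0.
End PointedK.

Section Measures.
Context {d : Order.disp_t} (K : orderTopologicalType d) (k0 : K) (R : realType).

Notation BorelK := (@g_sigma_algebraType (pointedK k0) (@open K)).

Definition radon (mu : {finite_measure set BorelK -> \bar R}) : Prop :=
  forall A : set K, @measurable _ BorelK A ->
    mu A = ereal_sup [set mu C | C in [set C : set K | compact C /\ C `<=` A]].

(** A signed Radon measure mu = mp - mn; F_mu(t) = mu([min K, t]) *)
Definition Fmu (mp mn : {finite_measure set BorelK -> \bar R}) (t : K) : R :=
  fine (mp [set` `]-oo, t]]) - fine (mn [set` `]-oo, t]]).

Definition pairing (mp mn : {finite_measure set BorelK -> \bar R}) (f : K -> R) : R :=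
  fine (\int[mp]_x (f x)%:E) - fine (\int[mn]_x (f x)%:E).

Definition weakstar_null {I : Type} (mp mn : I -> {finite_measure set BorelK -> \bar R}) : Prop :=
  forall f : K -> R, continuous f -> c0fam (fun i => pairing (mp i) (mn i) f).

Definition type_c0l1 {I : Type} (F : I -> K -> R) (Q : set K) : Prop :=
  exists (a b : I -> K -> R),
    (forall i t, Q t -> F i t = a i t + b i t) /\
    (forall t, Q t -> c0fam (fun i => a i t)) /\
    exists M : R, forall i, (\esum_(t in Q) (`|b i t|)%:E <= M%:E)%E.

(** K is separably determined (NBV(K) = C(K)^* realised as signed Radon
    measures mp - mn, mp, mn finite positive Radon measures) *)
Definition separably_determined_at : Prop :=
  forall (I : Type) (mp mn : I -> {finite_measure set BorelK -> \bar R}),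
    (forall i, radon (mp i) /\ radon (mn i)) ->
    weakstar_null mp mn ->
    forall Q : set K,
      (forall H : set K, closed H -> separable_set H ->
         countable [set t | Q t /\ H t /\ ~ plus_pts H t /\
                    ~ c0fam (fun i => Fmu (mp i) (mn i) t)]) ->
      type_c0l1 (fun i => Fmu (mp i) (mn i)) Q.

End Measures.

Definition separably_determined {d} (K : orderTopologicalType d) (R : realType) : Prop :=
  forall k0 : K, separably_determined_at k0 R.

(* Main.v *)
Require Import Defs.
From HB Require Import structures.
From mathcomp Require Import all_boot all_order all_algebra.
From mathcomp Require Import all_classical all_reals.
From mathcomp Require Import ereal esum topology normedtype measure lebesgue_integral.
From mathcomp Require Import sequences numfun lebesgue_stieltjes_measure.
From mathcomp Require Import measurable_realfun lra ring.
Set Implicit Arguments. Unset Strict Implicit. Unset Printing Implicit Defensive.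
Import Order.TTheory GRing.Theory Num.Theory.
Import numFieldNormedType.Exports.
Local Open Scope classical_set_scope.
Local Open Scope ring_scope.

(** A point of Q where the family is not null is not right-isolated, and (by
    inner regularity) has countable right character; hence only countably many
    F_i are nonzero there.  Call a set B of points essentially countable if for
    each i one may choose a countable set S_i such that, for t in B, the values
    F_i(t) with t outside S_i are null.  This is a sigma-ideal, and it contains
    every set of points t carrying pairwise disjoint intervals ]l_t, r_t] with
    l_t <= t <= r_t: a continuous f_t falling from 1 at l_t to 0 at r_t
    integrates to F_i(t) unless |mu_i| charges ]l_t, r_t].  In particular it
    contains the left-isolated points and the internal points of A \ Der A; the
    points with a separable adjacency are treated inside the maximal convex sets
    whose closed subintervals are separable, where the hypothesis on separable
    closed sets applies.

    Given the S_i, link two points when some i has both in S_i with nonzero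
    F_i.  Every index sees countably many points and every point countably many
    indices, so the components are countable.  Enumerate each component; since
    |F_i(t_1)| + ... + |F_i(t_n)| is eventually at most M + 1 with M a uniform
    norm bound, the summable part keeps F_i(t) when t is in S_i and the partial
    sum up to t is at most M + 1, which discards finitely many i for each t. *)

(** * Injective sequences in infinite index sets *)

Lemma infinite_set_seq (I : Type) (A : set I) : infinite_set A ->
  exists j : nat -> I, injective j /\ forall n, A (j n).
Proof.
move=> /infiniteP/card_leP[f]; exists (fun n => val (f (to_setT n))).
split=> [m n /val_inj e|n]; last exact: set_valP.
suff /(congr1 val) : to_setT m = to_setT n by [].
by apply: (@inj _ _ _ f) e; rewrite inE.
Qed.

Lemma infinite_range (I : Type) (j : nat -> I) : injective j -> infinite_set (range j).
Proof.
move=> jinj fj; apply: infinite_nat.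
apply: sub_finite_set (finite_preimage (f := j) _ fj) => [n _|m n _ _ /jinj //].
by exists n.
Qed.

(** * Distribution functions of Radon measures on a compact line *)

Section BorelMeasures.
Context {d : Order.disp_t} (K : orderTopologicalType d) (k0 : K) (R : realType).
Notation BorelK := (@g_sigma_algebraType (pointedK k0) (@open K)).
Implicit Types (m : {finite_measure set BorelK -> \bar R}) (f g : K -> R).

Definition distr m (t : K) : R := fine (m [set` `]-oo, t]]).

Lemma open_measurableK (A : set K) : open A -> @measurable _ BorelK A.
Proof. exact: sub_sigma_algebra. Qed.

Lemma closed_measurableK (A : set K) : closed A -> @measurable _ BorelK A.
Proof.
move=> cA; rewrite -(setCK A); apply: measurableC; apply: open_measurableK.
exact: closed_openC.
Qed.

Lemma lray_measurableK (t : K) : @measurable _ BorelK [set` `]-oo, t]].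
Proof. by apply: closed_measurableK; exact: lray_closed. Qed.

Lemma continuous_measurableK f : continuous f ->
  measurable_fun (setT : set BorelK) (f : BorelK -> R).
Proof.
move=> cf; apply: (measurability _ (RGenOInfty.measurableE R)) => _ [_ [x ->] <-].
rewrite setTI; apply: open_measurableK; by move/continuousP: cf; apply; exact: rray_open.
Qed.

Lemma continuous_integrable m f (c : R) : continuous f -> (forall x, `|f x| <= c) ->
  m.-integrable setT (EFin \o f : BorelK -> \bar R).
Proof.
move=> cf fc; apply: measurable_bounded_integrable => //.
- by rewrite ltey_eq fin_num_measure.
- exact: continuous_measurableK.
- exists c; split; first exact: num_real.
  by move=> y cy x _; exact: le_trans (fc x) (ltW cy).
Qed.

Lemma indic_integrable m (A : set K) : @measurable _ BorelK A ->
  m.-integrable setT (EFin \o \1_A : BorelK -> \bar R).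
Proof.
move=> mA; apply: measurable_bounded_integrable => //.
- by rewrite ltey_eq fin_num_measure.
- exists 1; split; first exact: num_real.
  move=> y /ltW cy x _ /=; apply: le_trans cy; rewrite indicE.
  by case: (x \in A); rewrite ?normr1 ?normr0.
Qed.

Lemma distr_le_Rintegral m f (c : R) t : continuous f -> (forall x, `|f x| <= c) ->
  (forall x, 0 <= f x) -> (forall x, (x <= t)%O -> 1 <= f x) ->
  distr m t <= Rintegral m setT f.
Proof.
move=> cf fc f0 f1.
have mt := lray_measurableK t.
have -> : distr m t = Rintegral m setT (\1_[set` `]-oo, t]]).
  by rewrite /Rintegral integral_indic // setIT.
apply: le_Rintegral => //.
- exact: indic_integrable.
- exact: continuous_integrable fc.
- move=> x _; case: (boolP (x \in _)) => [|_]; last exact: f0.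
  by rewrite inE /= in_itv /= => /f1.
Qed.

Lemma Rintegral_le_distr m f (c : R) t : continuous f -> (forall x, `|f x| <= c) ->
  (forall x, f x <= 1) -> (forall x, (t < x)%O -> f x <= 0) ->
  Rintegral m setT f <= distr m t.
Proof.
move=> cf fc f1 f0.
have mt := lray_measurableK t.
have -> : distr m t = Rintegral m setT (\1_[set` `]-oo, t]]).
  by rewrite /Rintegral integral_indic // setIT.
apply: le_Rintegral => //.
- exact: continuous_integrable fc.
- exact: indic_integrable.
- move=> x _; case: (boolP (x \in _)) => [_|]; first exact: f1.
  by rewrite notin_setE /= in_itv /= => /negP; rewrite -ltNge => /f0.
Qed.

Lemma le_distr m s t : (s <= t)%O -> distr m s <= distr m t.
Proof.
move=> st; apply: fine_le; rewrite ?fin_num_measure //; try exact: lray_measurableK.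
apply: le_measure; rewrite ?inE; try exact: lray_measurableK.
by move=> x /=; rewrite !in_itv /= => /le_trans; apply.
Qed.

(* A compact subset of the open ray above [t] misses an interval ]t,s[, so inner
   regularity of that ray gives the right continuity at [t]. *)
Lemma radon_distr_right m t (e : R) : radon m -> ~ right_isolated t -> 0 < e ->
  exists s, (t < s)%O /\ distr m s < distr m t + e.
Proof.
move=> rm nt e0.
have [u tu] : exists u, (t < u)%O.
  apply: contrapT => h; apply: nt; left => s.
  by rewrite leNgt; apply/negP => ts; apply: h; exists s.
have btw x : (t < x)%O -> exists s, (t < s)%O /\ (s < x)%O.
  move=> tx; apply: contrapT => h; apply: nt; right; exists x; split=> // v ?.
  by apply: h; exists v.
pose U : set K := [set` `]t, +oo[].
have oU : open U by exact: rray_open.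
have mU := open_measurableK oU.
have mUfin : m U \is a fin_num by rewrite fin_num_measure.
have := @ub_ereal_sup_adherent _
  [set m C | C in [set C : set K | compact C /\ C `<=` U]] e e0.
rewrite -(rm U mU) => /(_ mUfin) [_ [C [cC CU] <-]] mC.
have [s [ts Cs]] : exists s, (t < s)%O /\ C `<=` [set` `]s, +oo[].
  (* The implication is vacuous for [s <= t], so it can hold on a full neighbourhood of [t];
     compactness of [C] makes that neighbourhood independent of [x]. *)
  have : \forall s \near t, C `<=` [set x | (t < s)%O -> (s < x)%O].
    have /compact_near_coveringP := cC; apply.
    move=> x /CU; rewrite /U /= in_itv /= andbT => /btw[s [ts sx]].
    exists ([set` `]s, +oo[], [set` `]-oo, s[]) => /=.
      split; [apply: (@open_nbhs_nbhs _ x)|apply: (@open_nbhs_nbhs _ t)].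
        by split; [exact: rray_open|rewrite /= in_itv /= sx].
      by split; [exact: lray_open|rewrite /= in_itv].
    by move=> [y z] /= [+ + _]; rewrite !in_itv /= andbT => sy zs; exact: lt_trans sy.
  rewrite /prop_near1 itv_nbhsE => -[[l r] [oe tlr] lrC].
  have [s [ts slr]] : exists s, (t < s)%O /\ s \in Interval l r.
    have [b [tb br]] : exists b, (t < b)%O /\ (BLeft b <= r)%O.
      move: tlr oe; rewrite itv_boundlr => /andP[_].
      case: r {lrC} => [b r|b].
        by move=> + /itv_open_ends_rside b1; rewrite b1 bnd_simp => tr; exists r.
      by move=> _ /itv_open_ends_rinfty ->; exists u.
    have [s [ts sb]] := btw _ tb.
    exists s; split => //; move: tlr; rewrite !itv_boundlr => /andP[lt _]; apply/andP; split.
      by apply: le_trans lt _; rewrite bnd_simp ltW.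
    by apply: le_trans br; rewrite bnd_simp.
  by exists s; split=> // x Cx; rewrite /= in_itv /= andbT; exact: lrC Cx ts.
exists s; split => //.
have mt := lray_measurableK.
have mtf x : m [set` `]-oo, x]] \is a fin_num by rewrite fin_num_measure.
have mC' : @measurable _ BorelK C.
  by apply: closed_measurableK; apply: compact_closed => //; exact: order_hausdorff.
have mCfin : m C \is a fin_num by rewrite fin_num_measure.
have tot : m setT = (m [set` `]-oo, t]] + m U)%E.
  rewrite -measureU //; last first.
    apply/seteqP; split=> x //=; rewrite /U /= !in_itv /= andbT => -[/le_lt_trans h /h].
    by rewrite ltxx.
  congr (m _); apply/seteqP; split=> x //= _; rewrite /U /= !in_itv /= andbT.
  by have [|] := leP x t; [left|right].
(* [C] lies above [s], so the mass of []t, s]] is at most [m U - m C], which is less than [e]. *)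
have : (m [set` `]-oo, s]] + m C <= m setT)%E.
  rewrite -measureU //; last first.
    apply/seteqP; split=> x //= -[]; rewrite in_itv /= => xs /Cs.
    by rewrite /= in_itv /= andbT ltNge xs.
  apply: le_measure; rewrite ?inE //; exact: measurableU.
rewrite tot /distr; move: mC.
rewrite -(fineK mUfin) -(fineK mCfin) -(fineK (mtf s)) -(fineK (mtf t)).
rewrite -EFinN -!EFinD !lte_fin !lee_fin /=; lra.
Qed.

End BorelMeasures.

(** * Ramps and integrals against a signed measure *)

Definition ramp {d} {K : orderTopologicalType d} {R : realType} (f : K -> R) (l r : K) :=
  [/\ continuous f, forall x, 0 <= f x <= 1,
      forall x, (x <= l)%O -> f x = 1 & forall x, (r <= x)%O -> f x = 0].

(** Urysohn's lemma for the disjoint closed rays below [l] and above [r], a compact line being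
    normal. *)
Lemma ramp_exists {d} {K : orderTopologicalType d} (R : realType) (l r : K) :
  compact_line K -> (l < r)%O -> exists f : K -> R, ramp f l r.
Proof.
move=> cK lr.
have nK : normal_space K by apply: compact_normal => //; exact: order_hausdorff.
have sep : uniform_separator [set` `[r, +oo[] [set` `]-oo, l]].
  apply: ((@normal_separatorP R K).1 nK); [exact: rray_closed|exact: lray_closed|].
  apply/seteqP; split=> x //= -[]; rewrite !in_itv /= andbT => rx /(le_trans rx).
  by rewrite leNgt lr.
pose f : K -> R := Urysohn [set` `[r, +oo[] [set` `]-oo, l]].
exists f; split.
- exact: Urysohn_continuous.
- move=> x; have /= := @Urysohn_range K R [set` `[r, +oo[] [set` `]-oo, l]] (f x).
  by rewrite in_itv /=; apply; exists x.
- by move=> x xl; apply: (Urysohn_sub1 sep); exists x => //=; rewrite in_itv.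
- by move=> x xl; apply: (Urysohn_sub0 sep); exists x => //=; rewrite in_itv /= andbT.
Qed.

Section Pairings.
Context {d : Order.disp_t} (K : orderTopologicalType d) (k0 : K) (R : realType).
Context (cK : compact_line K).
Notation BorelK := (@g_sigma_algebraType (pointedK k0) (@open K)).
Context (mp mn : {finite_measure set BorelK -> \bar R}).
Implicit Types (f g : K -> R).

Lemma continuous_bounded f : continuous f -> exists c : R, forall x, `|f x| <= c.
Proof.
move=> cf.
have : compact (f @` [set: K]).
  by apply: continuous_compact => //; exact: continuous_subspaceT.
move=> /compact_bounded[c [_ h]]; exists (c + 1) => x.
by apply: h; [rewrite ltrDl|exists x].
Qed.

Lemma pairing_linear f g (c : R) : continuous f -> continuous g ->
  pairing mp mn (fun x => f x + c * g x) = pairing mp mn f + c * pairing mp mn g.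
Proof.
move=> cf cg; have [a fa] := continuous_bounded cf; have [b gb] := continuous_bounded cg.
have ccg : continuous (fun x => c * g x) by move=> x; apply: cvgM; [exact: cvg_cst|exact: cg].
have [b' cgb] := continuous_bounded ccg.
have E (m : {finite_measure set BorelK -> \bar R}) :
    Rintegral m setT (fun x => f x + c * g x) = Rintegral m setT f + c * Rintegral m setT g.
  rewrite RintegralD //; [|exact: continuous_integrable fa|exact: continuous_integrable cgb].
  by rewrite RintegralZl //; exact: continuous_integrable gb.
have := (E mp, E mn); rewrite /Rintegral /pairing => -[-> ->]; ring.
Qed.

Lemma Rintegral_bound (m : {finite_measure set BorelK -> \bar R}) f (e : R) :
  continuous f -> (forall x, `|f x| <= e) -> `|Rintegral m setT f| <= fine (m setT) * e.
Proof.
move=> cf fe.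
have ie := continuous_integrable m cf fe.
have e0 : 0 <= e by apply: le_trans (fe k0).
have ic : m.-integrable setT (EFin \o cst e : BorelK -> \bar R).
  apply: (@continuous_integrable _ _ _ _ _ _ e) => [x|x]; first exact: cvg_cst.
  by rewrite /= ger0_norm.
rewrite mulrC -Rintegral_cst //; apply: le_trans (le_normr_Rintegral _ ie) _ => //.
by apply: le_Rintegral => //; exact: integrable_norm ie.
Qed.

Lemma pairing_bound f (e : R) : continuous f -> (forall x, `|f x| <= e) ->
  `|pairing mp mn f| <= (fine (mp setT) + fine (mn setT)) * e.
Proof.
move=> cf fe; rewrite mulrDl; apply: le_trans (ler_normB _ _) _.
by apply: lerD; exact: Rintegral_bound.
Qed.

(** For each of [mp] and [mn], the distribution function at [t] and the integral of [f] both lie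
    between the values at [l] and at [r]; the error is thus at most the mass that [mp + mn] gives to
    []l, r]]. *)
Lemma Fmu_ramp f l r t : ramp f l r -> (l <= t)%O -> (t <= r)%O ->
  `|Fmu mp mn t - pairing mp mn f| <= (distr mp r + distr mn r) - (distr mp l + distr mn l).
Proof.
move=> [cf f01 fl fr] lt tr.
have fb x : `|f x| <= 1 by have /andP[f0 f1] := f01 x; rewrite ger0_norm.
have L (m : {finite_measure set BorelK -> \bar R}) :
    distr m l <= Rintegral m setT f <= distr m r.
  apply/andP; split.
    apply: distr_le_Rintegral fb _ _ => // x; first by have /andP[] := f01 x.
    by move=> /fl->.
  apply: Rintegral_le_distr fb _ _ => // x; first by have /andP[] := f01 x.
  by move=> /ltW /fr->.
have := (L mp, L mn); have := (le_distr mp lt, le_distr mn lt).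
have := (le_distr mp tr, le_distr mn tr).
rewrite /Rintegral /pairing /Fmu -/(distr mp t) -/(distr mn t).
move=> [] ? ? [] ? ? [] /andP[? ?] /andP[? ?]; rewrite ler_norml; lra.
Qed.

(** Across a jump the ramp is the indicator of []-oo, t]] itself, so no error remains. *)
Lemma Fmu_jump f s t : ramp f t s -> (forall u, ~ ((t < u)%O /\ (u < s)%O)) ->
  Fmu mp mn t = pairing mp mn f.
Proof.
move=> [cf f01 fl fr] ts.
have fb x : `|f x| <= 1 by have /andP[f0 f1] := f01 x; rewrite ger0_norm.
have E (m : {finite_measure set BorelK -> \bar R}) : distr m t = Rintegral m setT f.
  apply/eqP; rewrite eq_le; apply/andP; split.
    apply: distr_le_Rintegral fb _ _ => // x; first by have /andP[] := f01 x.
    by move=> /fl->.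
  apply: Rintegral_le_distr fb _ _ => // x; first by have /andP[] := f01 x.
  by move=> tx; rewrite fr // leNgt; apply/negP => xs; exact: ts (conj tx xs).
by rewrite /Fmu -/(distr mp t) -/(distr mn t) !E.
Qed.

Lemma Fmu_max t : is_maxK t -> Fmu mp mn t = pairing mp mn (cst 1).
Proof.
move=> mt; rewrite /Fmu /pairing.
have -> : [set` `]-oo, t]] = setT :> set K by apply/seteqP; split=> x //= _; rewrite in_itv /=.
have E (m : {finite_measure set BorelK -> \bar R}) :
    fine (\int[m]_x ((cst 1 : K -> R) x)%:E) = fine (m setT).
  by rewrite -[RHS]mul1r -Rintegral_cst.
by rewrite !E.
Qed.
End Pairings.

(** * Null families of functionals *)

(* [T i] stands for integration against [mu_i], [F i] for its distribution function
   and [V i] for that of a positive measure dominating [|mu_i|]. *)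
Section TailSystems.
Context {d : Order.disp_t} (K : orderTopologicalType d) (R : realType) (I : Type).
Context (cK : compact_line K) (k0 : K) (T : I -> (K -> R) -> R) (F V : I -> K -> R).
Context
  (T_linear : forall i (f g : K -> R) (c : R), continuous f -> continuous g ->
    T i (fun x => f x + c * g x) = T i f + c * T i g)
  (T_bound : forall i, exists C : R, forall (f : K -> R) (e : R), continuous f ->
    (forall x, `|f x| <= e) -> `|T i f| <= C * e)
  (T_null : forall f : K -> R, continuous f -> c0fam (fun i => T i f))
  (F_ramp : forall i f l r t, ramp f l r -> (l <= t)%O -> (t <= r)%O ->
    `|F i t - T i f| <= V i r - V i l)
  (F_jump : forall i f s t, ramp f t s -> (forall u, ~ ((t < u)%O /\ (u < s)%O)) ->
    F i t = T i f)
  (F_max : forall i t, is_maxK t -> F i t = T i (cst 1))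
  (V_mono : forall i s t, (s <= t)%O -> V i s <= V i t)
  (V_right : forall i t (e : R), ~ right_isolated t -> 0 < e ->
    exists s, (t < s)%O /\ V i s < V i t + e).
Implicit Types (f g : K -> R) (t s : K).

Lemma T_zero i : T i (cst 0) = 0.
Proof.
have [C /(_ (cst 0) 0)] := T_bound i; rewrite mulr0 normr_le0 => h.
by apply/eqP/h => [x|x]; [exact: cvg_cst|rewrite /= normr0].
Qed.

Lemma continuous_lincomb f g (c : R) : continuous f -> continuous g ->
  continuous (fun x => f x + c * g x).
Proof.
move=> cf cg x; apply: cvgD; first exact: cf.
by apply: cvgM; [exact: cvg_cst|exact: cg].
Qed.

Lemma T_scale i f (c : R) : continuous f -> T i (fun x => c * f x) = c * T i f.
Proof.
move=> cf; have := @T_linear i (cst 0) f c (fun x => cvg_cst _) cf.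
by rewrite T_zero add0r => <-; congr (T i _); apply/funext => x /=; rewrite add0r.
Qed.

Lemma finite_set_bounded (A : set I) (g : I -> R) : finite_set A ->
  exists B, forall i, A i -> g i <= B.
Proof.
move=> /(finite_image g)/finite_seqP[s sE].
suff [B sB] : exists B, forall y, y \in s -> y <= B.
  exists B => i Ai; apply: sB.
  by have : (g @` A) (g i) := imageP g Ai; rewrite sE.
elim: {sE} s => [|y s [B sB]]; first by exists 0.
exists (Num.max y B) => z; rewrite inE le_max => /orP[/eqP->|/sB->]; rewrite ?lexx ?orbT //.
Qed.

(* [x - r] increases and [x + r] decreases, so the limit is a supremum. *)
Lemma shrinking_limit (x : nat -> R) (r : nat -> R) :
  (forall n, `|x n.+1 - x n| <= r n - r n.+1) -> (forall n, 0 <= r n) ->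
  exists y, forall n, `|y - x n| <= r n.
Proof.
move=> xr r0.
have lo m n : (m <= n)%N -> x m - r m <= x n - r n /\ x n + r n <= x m + r m.
  move=> /subnK <-; elim: (n - m)%N => [|j [IH1 IH2]]; first by rewrite add0n.
  by rewrite addSn; have := xr (j + m)%N; rewrite ler_norml => /andP[]; split; lra.
have cross m n : x m - r m <= x n + r n.
  have [mn|/ltnW nm] := leqP m n.
    by have [h _] := lo _ _ mn; have := r0 n; lra.
  by have [_ h] := lo _ _ nm; have := r0 m; lra.
pose A := [set x m - r m | m in [set: nat]].
have hA : has_sup A.
  by split; [exists (x 0 - r 0), 0%N|exists (x 0 + r 0) => _ [m _ <-]].
exists (sup A) => n; rewrite ler_norml; apply/andP; split.
  have : x n - r n <= sup A by apply: sup_upper_bound => //; exists n.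
  lra.
have : sup A <= x n + r n by apply: ge_sup; [case: hA|move=> _ [m _ <-]].
lra.
Qed.

(* Banach-Steinhaus by a gliding hump: [x k.+1] is [x k] plus or minus [3^-k] times
   an almost norming function of [T (ih k).1], the sign being chosen so that one of
   the two values is at least [3^-k] times the value at the hump; the later humps
   add up to at most half of that. *)
Lemma uniform_bound : exists M : R, 0 <= M /\ forall i f, continuous f ->
  (forall x, `|f x| <= 1) -> `|T i f| <= M.
Proof.
apply: contrapT => nM.
have big (B : R) : exists i f, [/\ continuous f, forall x, `|f x| <= 1 & B < `|T i f|].
  apply: contrapT => h; apply: nM; exists (Num.max B 0); split.
    by rewrite le_max lexx orbT.
  move=> i f cf f1; rewrite le_max leNgt; apply/orP; left; apply/negP => Bf.
  by apply: h; exists i, f.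
pose ball1 i := [set `|T i f| | f in [set f | continuous f /\ forall x, `|f x| <= 1]].
pose L i := sup (ball1 i).
have supL i : has_sup (ball1 i).
  split.
    exists `|T i (cst 0)|, (cst 0) => //.
    by split=> x; [exact: cvg_cst|rewrite normr0].
  by have [C hC] := T_bound i; exists (C * 1) => _ [f [cf f1] <-]; exact: hC.
have TL i (f : K -> R) : continuous f -> (forall x, `|f x| <= 1) -> `|T i f| <= L i.
  by move=> cf f1; apply: sup_upper_bound => //; exists f.
have TLe i f (e : R) : continuous f -> 0 < e -> (forall x, `|f x| <= e) -> `|T i f| <= L i * e.
  move=> cf e0 fe; rewrite -ler_pdivrMr //.
  have := TL i (fun x => e^-1 * f x).
  rewrite T_scale // normrM (gtr0_norm (x := e^-1)) ?invr_gt0 //.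
  rewrite mulrC; apply.
    by move=> x; apply: cvgM; [exact: cvg_cst|exact: cf].
  by move=> x; rewrite normrM gtr0_norm ?invr_gt0 // mulrC ler_pdivrMr // mul1r.
pose r (n : nat) : R := (3^-1) ^+ n.
have r_gt0 n : 0 < r n by rewrite exprn_gt0 // invr_gt0.
have rS n : r n.+1 = r n / 3 by rewrite /r exprS mulrC.
(* The constants leave a margin: the hump contributes at least [3 / 4 * L * r k], the later humps at
   most [L * r k / 2], and the difference [L * r k / 4] exceeds [k.+1]. *)
have step (k : nat) : exists ih : I * (K -> R), [/\ continuous ih.2, forall x, `|ih.2 x| <= 1,
    (k.+1%:R : R) < L ih.1 * r k / 4 & 3 / 4 * L ih.1 < `|T ih.1 ih.2|].
  have [i [f [cf f1 Tf]]] := big (k.+1%:R * 4 / r k).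
  have Lgt : k.+1%:R * 4 / r k < L i by apply: lt_le_trans Tf _; exact: TL.
  have L0 : 0 < L i by apply: le_lt_trans Lgt; rewrite divr_ge0 ?mulr_ge0 // ltW.
  have [|_ [h [ch h1] <-] hT] := @sup_adherent _ (ball1 i) (L i / 4) _ (supL i).
    by rewrite divr_gt0.
  exists (i, h); split => //=.
    by move: Lgt; rewrite ltr_pdivrMr // ltr_pdivlMr.
  by move: hT; rewrite -/(L i); lra.
have {}[ih ihP] := choice step.
pose nxt k x := fun s : R => fun t => x t + (s * r k) * (ih k).2 t.
pose fix x (n : nat) : K -> R := if n is k.+1 then
  (if `|T (ih k).1 (nxt k (x k) (-1))| <= `|T (ih k).1 (nxt k (x k) 1)|
   then nxt k (x k) 1 else nxt k (x k) (-1)) else cst 0.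
have xS k : exists s : R, `|s| = 1 /\ x k.+1 = nxt k (x k) s.
  by rewrite /=; case: ifP => _; [exists 1|exists (-1)]; rewrite ?normrN normr1.
have cx n : continuous (x n).
  elim: n => [|k IH]; first by move=> t; exact: cvg_cst.
  have [s [_ ->]] := xS k; apply: continuous_lincomb => //; by have [] := ihP k.
have Tx k : r k * `|T (ih k).1 (ih k).2| <= `|T (ih k).1 (x k.+1)|.
  have [ch _ _ _] := ihP k.
  have e1 := @T_linear (ih k).1 (x k) (ih k).2 (1 * r k) (cx k) ch.
  have e2 := @T_linear (ih k).1 (x k) (ih k).2 (-1 * r k) (cx k) ch.
  have rk := r_gt0 k.
  suff : 2 * (r k * `|T (ih k).1 (ih k).2|) <= 2 * `|T (ih k).1 (x k.+1)| by rewrite ler_pM2l.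
  have -> : 2 * (r k * `|T (ih k).1 (ih k).2|) =
     `|T (ih k).1 (nxt k (x k) 1) - T (ih k).1 (nxt k (x k) (-1))|.
    rewrite /nxt e1 e2 -(gtr0_norm rk) -normrM -[X in X * _](@ger0_norm R 2) // -normrM.
    by rewrite (gtr0_norm rk); congr `|_|; ring.
  apply: le_trans (ler_normB _ _) _; rewrite /=; case: ifP => [|/negbT].
    lra.
  by rewrite -ltNge; lra.
(* [3 / 2 * r n] is the sum of the geometric tail [r j] over [j >= n]. *)
have [y yx] : exists y : K -> R, forall n t, `|y t - x n t| <= 3 / 2 * r n.
  have : forall t, exists z, forall n, `|z - x n t| <= 3 / 2 * r n.
    move=> t; apply: shrinking_limit => n; last by rewrite mulr_ge0 // ltW.
    have [s [s1 ->]] := xS n; have [_ h1 _ _] := ihP n.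
    rewrite /nxt addrC addKr !normrM s1 mul1r (gtr0_norm (r_gt0 n)) rS.
    have : r n * `|(ih n).2 t| <= r n * 1 by rewrite ler_pM2l.
    lra.
  by move=> /choice[y yP]; exists y => n t.
have cy : continuous y.
  move=> t; apply/cvgrPdist_lt => e e0.
  have [n rn] : exists n, r n < e / 6.
    have /cvgrPdist_lt/(_ (e / 6)) : r @ \oo --> (0 : R).
      by apply: cvg_expr; rewrite ger0_norm ?invr_ge0 // invf_lt1 // ltr1n.
    rewrite divr_gt0 // => /(_ isT)[n _ /(_ n (leqnn n))] /=.
    by rewrite sub0r normrN gtr0_norm // => ?; exists n.
  have /cvgrPdist_lt/(_ (e / 3)) := cx n t; rewrite divr_gt0 // => /(_ isT).
  apply: filterS => u xtu.
  have -> : y t - y u = (y t - x n t) + (x n t - x n u) - (y u - x n u) by ring.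
  apply: le_lt_trans (ler_normB _ _) _.
  have := ler_normD (y t - x n t) (x n t - x n u); have := yx n t; have := yx n u; lra.
have Ty k : k.+1%:R <= `|T (ih k).1 y|.
  have [ch _ Lk Tk] := ihP k.
  have : T (ih k).1 y = T (ih k).1 (x k.+1) + 1 * T (ih k).1 (fun t => y t + (-1) * x k.+1 t).
    rewrite -T_linear //; last exact: continuous_lincomb.
    by congr (T _ _); apply/funext => t /=; ring.
  rewrite mul1r => ->.
  have := TLe (ih k).1 (fun t => y t + (-1) * x k.+1 t) (r k / 2).
  move=> /(_ (continuous_lincomb (c := -1) cy (cx k.+1))); rewrite divr_gt0 // => /(_ isT).
  set z := T _ (fun t => y t + _) => hz.
  have {}hz : `|z| <= L (ih k).1 * (r k / 2).
    by apply: hz => t; rewrite mulN1r; have := yx k.+1 t; rewrite rS; lra.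
  have := Tx k.
  have : r k * (3 / 4 * L (ih k).1) <= r k * `|T (ih k).1 (ih k).2| by rewrite ler_pM2l // ltW.
  have := lerB_normD (T (ih k).1 (x k.+1)) z; lra.
(* Nullity at [y] with threshold 1 leaves finitely many indices, so the values there are bounded,
   against the lower bounds [k.+1]. *)
have [B hB] := finite_set_bounded (fun i => `|T i y|) (T_null cy ltr01).
have [k Bk] : exists k : nat, B < k.+1%:R.
  by exists (Num.truncn `|B|); apply: le_lt_trans (ler_norm B) _; exact: truncnS_gt.
have := hB (ih k).1; rewrite /=.
have := Ty k; have : (1 : R) <= k.+1%:R by rewrite ler1n.
move=> h1 h2 /(_ (le_trans h1 h2)); lra.
Qed.

(** * Nullity, right character and support at a single point *)

Lemma not_right_isolated_gt t : ~ right_isolated t -> exists s, (t < s)%O.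
Proof.
move=> nt; apply: contrapT => h; apply: nt; left => s.
by rewrite leNgt; apply/negP => ts; apply: h; exists s.
Qed.

Lemma c0fam_le (a b : I -> R) : (forall i, `|a i| <= `|b i|) -> c0fam b -> c0fam a.
Proof.
move=> ab cb e /cb; apply: sub_finite_set => i /= ea; exact: le_trans (ab i).
Qed.

Lemma right_isolated_c0 t : right_isolated t -> c0fam (F^~ t).
Proof.
case=> [mt|[s [ts st]]].
  by apply: c0fam_le (T_null (f := cst 1) _) => [i|x]; [rewrite F_max|exact: cvg_cst].
have [f rf] := ramp_exists R cK ts; have [cf _ _ _] := rf.
by apply: c0fam_le (T_null cf) => i; rewrite (F_jump _ rf).
Qed.

Lemma c0fam_infinite (a : I -> R) : ~ c0fam a ->
  exists e, 0 < e /\ exists j : nat -> I, injective j /\ forall n, e <= `|a (j n)|.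
Proof.
move=> na; have [e [e0 Ae]] : exists e, 0 < e /\ infinite_set [set i | e <= `|a i|].
  by apply: contrapT => h; apply: na => e e0; apply: contrapT => h'; apply: h; exists e.
have [j [jinj jA]] := infinite_set_seq Ae.
by exists e; split => //; exists j.
Qed.

(** For infinitely many indices [j n] the value at [t] is at least [e], and [V (j n)] grows by less
    than [e / 2] up to some [s n > t]. If the right character were uncountable, one [v > t] would
    lie below all [s n], and the ramp from [t] to [v] would contradict [T_null]. *)
Lemma not_c0_countable_right_char t : ~ c0fam (F^~ t) -> countable_right_char t.
Proof.
move=> nt; apply: contrapT => nr.
have nri : ~ right_isolated t by move=> rt; apply: nr; left.
have [e [e0 [j [jinj je]]]] := c0fam_infinite nt.
have {}/choice[s sP] : forall n, exists s, (t < s)%O /\ V (j n) s < V (j n) t + e / 2.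
  by move=> n; apply: V_right => //; rewrite divr_gt0.
have [v [vs tv]] : exists v, (forall n, (v <= s n)%O) /\ (t < v)%O.
  apply: contrapT => h; apply: nr; right; exists (range s).
  split; first exact: sub_countable (card_image_le _ _) _.
  split=> [_ [n _ <-]|]; first by have [] := sP n.
  split=> [_ [n _ <-]|v hv]; first by have [/ltW] := sP n.
  rewrite leNgt; apply/negP => tv; apply: h; exists v; split=> // n.
  by apply: hv; exists n.
have [f rf] := ramp_exists R cK tv; have [cf _ _ _] := rf.
suff : infinite_set [set i | e / 2 <= `|T i f|].
  by apply; apply: (T_null cf); rewrite divr_gt0.
apply: sub_infinite_set (infinite_range jinj) => _ [n _ <-] /=; have [_ h] := sP n.
have := F_ramp (j n) rf (lexx _) (ltW tv); have := V_mono (j n) (vs n); have := je n.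
have := ler_normD (F (j n) t - T (j n) f) (T (j n) f); rewrite subrK; lra.
Qed.

(** If [F i t] is nonzero, the ramp from [t] to some [a] in [A] close enough to [t] has a nonzero
    integral. Each of these countably many ramps is seen by countably many indices only, by
    [T_null]. *)
Lemma countable_right_char_support t : ~ right_isolated t -> countable_right_char t ->
  countable [set i | F i t != 0].
Proof.
move=> nt [//|[A [cA [tA [_ infA]]]]].
have /choice[f fP] : forall a, exists f : K -> R, (t < a)%O -> ramp f t a.
  move=> a; have [ta|ta] := pselect (t < a)%O; last by exists (cst 0).
  by have [f rf] := ramp_exists R cK ta; exists f.
apply: (@sub_countable _ _ _
  (\bigcup_(a in A) \bigcup_n [set i | (n.+1%:R)^-1 <= `|T i (f a)|])).
  apply: subset_card_le => i /= Fi0.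
  have [s [ts Vs]] : exists s, (t < s)%O /\ V i s < V i t + `|F i t|.
    by apply: V_right; rewrite ?normr_gt0.
  have [a [Aa as_]] : exists a, A a /\ (a < s)%O.
    apply: contrapT => h; suff : (s <= t)%O by rewrite leNgt ts.
    apply: infA => a Aa.
    by rewrite leNgt; apply/negP => as_; apply: h; exists a.
  exists a => //; have ra := fP a (tA a Aa).
  have Tpos : 0 < `|T i (f a)|.
    have := F_ramp i ra (lexx _) (ltW (tA a Aa)); have := V_mono i (ltW as_).
    have := ler_normD (F i t - T i (f a)) (T i (f a)); rewrite subrK; lra.
  exists (Num.truncn (`|T i (f a)|^-1)) => //=.
  by rewrite invf_ple ?posrE // ltW // truncnS_gt.
apply: bigcup_countable => // a Aa; apply: bigcup_countable => // n _.
have [ca _ _ _] := fP a (tA a Aa).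
by apply: finite_set_countable; apply: (T_null ca); rewrite invr_gt0.
Qed.

(** * Finite sums of values of one member of the family *)

Lemma gap_above (S : seq K) t : (exists s, (t < s)%O) ->
  exists s, (t < s)%O /\ forall x, x \in S -> (t < x)%O -> (s <= x)%O.
Proof.
move=> [u tu]; elim: S => [|y S [s [ts sS]]]; first by exists u.
have [ty|yt] := ltP t y.
  exists (Order.min s y); rewrite lt_min ts ty; split=> // x.
  rewrite inE => /orP[/eqP-> _|xS tx]; first by rewrite ge_min lexx orbT.
  by rewrite ge_min sS.
exists s; split=> // x; rewrite inE => /orP[/eqP->|]; last exact: sS.
by rewrite ltNge yt.
Qed.

Lemma sum_disjoint_bumps (S : seq K) (g : K -> R) : uniq S ->
  (forall t, t \in S -> `|g t| <= 1) ->
  (forall t u, t \in S -> u \in S -> t != u -> g t != 0 -> g u = 0) ->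
  `|\sum_(t <- S) g t| <= 1.
Proof.
move=> uS g1 dis.
have [/hasP[t tS gt]|/hasPn h] := boolP (has (fun t => g t != 0) S).
  rewrite (bigD1_seq t) //= big1_seq ?addr0 ?g1 // => u /andP[ut uS'].
  by apply: (dis t) => //; rewrite eq_sym.
by rewrite big1_seq ?normr0 ?ler01 // => t /= tS; apply/eqP; have := h t tS; rewrite negbK.
Qed.

Lemma T_sum i (S : seq K) (c : K -> R) (g : K -> K -> R) :
  (forall t, t \in S -> continuous (g t)) ->
  continuous (fun x => \sum_(t <- S) c t * g t x) /\
  T i (fun x => \sum_(t <- S) c t * g t x) = \sum_(t <- S) c t * T i (g t).
Proof.
elim: S => [|t S IH] gc.
  under eq_fun do rewrite big_nil; rewrite big_nil; split; last exact: T_zero.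
  by move=> x; exact: cvg_cst.
have [|IH1 IH2] := IH; first by move=> u uS; apply: gc; rewrite inE uS orbT.
have gt : continuous (g t) by apply: gc; rewrite mem_head.
have -> : (fun x => \sum_(u <- t :: S) c u * g u x) =
    (fun x => \sum_(u <- S) c u * g u x + c t * g t x).
  by apply/funext => x; rewrite big_cons addrC.
split; first exact: continuous_lincomb.
by rewrite T_linear // IH2 big_cons addrC.
Qed.

(** The ramps [f t] are fixed, so all but finitely many [i] have small [T i (f t)]. For such [i],
    steeper ramps [h t] approximate [F i t], and the differences [h t - f t] have disjoint supports:
    their signed sum is bounded by 1, so [M] bounds the sum of the absolute values. *)
Lemma finite_sum_bound (M : R) (S : seq K) :
  (forall i (f : K -> R), continuous f -> (forall x, `|f x| <= 1) -> `|T i f| <= M) ->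
  uniq S -> (forall t, t \in S -> ~ right_isolated t) ->
  finite_set [set i | M + 1 < \sum_(t <- S) `|F i t|].
Proof.
move=> hM uS nS.
have /choice[s sP] : forall t, exists s, t \in S ->
    (t < s)%O /\ forall x, x \in S -> (t < x)%O -> (s <= x)%O.
  move=> t; have [tS|] := boolP (t \in S); last by exists t.
  by have [s sP] := gap_above S (not_right_isolated_gt (nS t tS)); exists s.
have /choice[f fP] : forall t, exists f : K -> R, t \in S -> ramp f t (s t).
  move=> t; have [tS|] := boolP (t \in S); last by exists (cst 0).
  by have [ts _] := sP t tS; have [f rf] := ramp_exists R cK ts; exists f.
(* Each point of [S] costs [2 * e], once for [f t] and once for the growth of [V i] up to [u t];
   this [n] keeps the total below 1. *)
pose n : R := (size S)%:R * 2 + 1; have n0 : 0 < n by rewrite ltr_wpDl // mulr_ge0.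
pose e := n^-1; have e0 : 0 < e by rewrite invr_gt0.
apply: (@sub_finite_set _ _ (\bigcup_(t in [set` S]) [set i | e <= `|T i (f t)|])); last first.
  apply: bigcup_finite => // t /= tS; have [cf _ _ _] := fP t tS; exact: (T_null cf).
move=> i /= big; apply: contrapT => small.
have {}small t : t \in S -> `|T i (f t)| < e.
  by move=> tS; rewrite ltNge; apply/negP => h; apply: small; exists t.
have /choice[u uP] : forall t, exists u, t \in S ->
    [/\ (t < u)%O, (u <= s t)%O & V i u < V i t + e].
  move=> t; have [tS|] := boolP (t \in S); last by exists t.
  have [v [tv Vv]] := V_right i (nS t tS) e0; have [ts _] := sP t tS.
  exists (Order.min v (s t)) => _; rewrite lt_min tv ts ge_min lexx orbT; split => //.
  by apply: le_lt_trans Vv; apply: V_mono; rewrite ge_min lexx.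
have /choice[h hP] : forall t, exists h : K -> R, t \in S -> ramp h t (u t).
  move=> t; have [tS|] := boolP (t \in S); last by exists (cst 0).
  by have [tu _ _] := uP t tS; have [h rh] := ramp_exists R cK tu; exists h.
(* Subtracting [f t] confines the support to []t, s t[], before the next point of [S]. *)
pose g t x := h t x + (-1) * f t x.
have cg t : t \in S -> continuous (g t).
  by move=> tS; have [? _ _ _] := fP t tS; have [? _ _ _] := hP t tS; exact: continuous_lincomb.
have Tg t : t \in S -> T i (g t) = T i (h t) - T i (f t).
  move=> tS; have [? _ _ _] := fP t tS; have [? _ _ _] := hP t tS.
  by rewrite T_linear // mulN1r.
have gsupp t x : t \in S -> g t x != 0 -> (t < x)%O /\ (x < s t)%O.
  move=> tS; have [_ _ f1 f0] := fP t tS; have [_ _ h1 h0] := hP t tS; have [_ us _] := uP t tS.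
  move=> gx; split; rewrite ltNge; apply: contra_neqN gx => le; rewrite /g.
    by rewrite f1 // h1 //; ring.
  by rewrite f0 // h0 ?(le_trans us) //; ring.
have gb t x : t \in S -> `|g t x| <= 1.
  move=> tS; have [_ f01 _ _] := fP t tS; have [_ h01 _ _] := hP t tS.
  by have /andP[? ?] := f01 x; have /andP[? ?] := h01 x; rewrite /g ler_norml; lra.
pose c t := Num.sg (T i (g t)).
have [cc TE] := T_sum i c cg.
have bound : \sum_(t <- S) `|T i (g t)| <= M.
  have -> : \sum_(t <- S) `|T i (g t)| = T i (fun x => \sum_(t <- S) c t * g t x).
    by rewrite TE; apply: eq_bigr => t _; rewrite normrEsg.
  apply: le_trans (ler_norm _) _; apply: hM => // x; apply: sum_disjoint_bumps => //.
    move=> t tS; rewrite normrM; apply: mulr_ile1 => //; last exact: gb.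
    by rewrite normr_sg; case: (_ == 0).
  move=> t v tS vS tv; rewrite mulf_eq0 negb_or => /andP[_ /(gsupp _ _ tS)[tx xt]].
  have [->|/(gsupp _ _ vS)[vx xv]] := eqVneq (g v x) 0; first by rewrite mulr0.
  have [_ sT] := sP t tS; have [_ sV] := sP v vS; move: tv.
  have [lt|lt|tv] := ltgtP t v; last by [].
    by have := lt_trans (le_lt_trans (sT v vS lt) vx) xt; rewrite ltxx.
  by have := lt_trans (le_lt_trans (sV t tS lt) tx) xv; rewrite ltxx.
suff : \sum_(t <- S) `|F i t| <= \sum_(t <- S) (`|T i (g t)| + 2 * e).
  rewrite big_split /= big_const_seq count_predT iter_addr_0 -[_ *+ size S]mulr_natr.
  have : n * e = 1 by rewrite mulfV // gt_eqF.
  rewrite /n => ne le; suff : \sum_(t <- S) `|F i t| <= M + 1 by rewrite leNgt big.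
  by apply: le_trans le _; apply: lerD => //; nra.
rewrite big_seq [X in _ <= X]big_seq; apply: ler_sum => t tS.
have [tu us Vu] := uP t tS; have := F_ramp i (hP t tS) (lexx _) (ltW tu).
have := small t tS; have := Tg t tS => Tgt.
have := ler_normD (F i t - T i (h t)) (T i (g t) + T i (f t)).
have := ler_normD (T i (g t)) (T i (f t)).
have -> : F i t - T i (h t) + (T i (g t) + T i (f t)) = F i t by rewrite Tgt; ring.
lra.
Qed.

(** * Essentially countable sets *)

Definition essentially_countable (B : set K) := exists S : I -> set K,
  (forall i, countable (S i)) /\
  forall t, B t -> forall e : R, 0 < e -> finite_set [set i | ~ S i t /\ e <= `|F i t|].

Lemma essentially_countableS (A B : set K) : A `<=` B ->
  essentially_countable B -> essentially_countable A.
Proof. by move=> AB [S [cS hS]]; exists S; split=> // t /AB; exact: hS. Qed.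

Lemma essentially_countable_bigcup (A : nat -> set K) :
  (forall n, essentially_countable (A n)) -> essentially_countable (\bigcup_n A n).
Proof.
move=> /choice[S hS]; exists (fun i => \bigcup_n S n i); split.
  by move=> i; apply: bigcup_countable => // n _; have [] := hS n.
move=> t [n _ At] e e0; have [_ /(_ t At e e0)] := hS n.
by apply: sub_finite_set => i /= [nS]; split => // St; apply: nS; exists n.
Qed.

Lemma essentially_countableU (A B : set K) : essentially_countable A ->
  essentially_countable B -> essentially_countable (A `|` B).
Proof.
move=> eA eB; apply: (@essentially_countableS _ (\bigcup_n (if n is 0%N then A else B))).
  by move=> t [At|Bt]; [exists 0%N|exists 1%N].
by apply: essentially_countable_bigcup => -[].
Qed.

Lemma countable_essentially_countable (B : set K) : countable B -> essentially_countable B.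
Proof.
move=> cB; exists (fun=> B); split=> // t Bt e _.
by rewrite (_ : [set i | _] = set0) //; apply/seteqP; split=> i //= -[].
Qed.

(** Where [V i] does not grow from [l t] to [r t], the error in [F_ramp] vanishes and [F i t] is the
    integral of a ramp independent of [i]. *)
Lemma essentially_countable_intervals (B : set K) (l r : K -> K) :
  (forall t, B t -> [/\ (l t <= t)%O, (t <= r t)%O & (l t < r t)%O]) ->
  (forall i, countable [set t | B t /\ V i (l t) < V i (r t)]) ->
  essentially_countable B.
Proof.
move=> Blr cB; exists (fun i => [set t | B t /\ V i (l t) < V i (r t)]); split=> // t Bt e e0.
have [lt tr ltr] := Blr t Bt; have [f rf] := ramp_exists R cK ltr; have [cf _ _ _] := rf.
apply: sub_finite_set (T_null cf e0) => i /= [nS eF].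
have Vle : V i (r t) <= V i (l t) by rewrite leNgt; apply/negP => h; apply: nS.
have := F_ramp i rf lt tr; have := ler_normD (F i t - T i f) (T i f); rewrite subrK; lra.
Qed.

Lemma countable_disjoint_jumps (g : K -> R) (B : set K) (l r : K -> K) :
  (forall s t, (s <= t)%O -> g s <= g t) ->
  (forall t u, B t -> B u -> t != u -> (r t <= l u)%O \/ (r u <= l t)%O) ->
  countable [set t | B t /\ g (l t) < g (r t)].
Proof.
move=> gm dis.
(* Disjoint intervals on which [g] increases contain distinct rationals in their images. *)
have /choice[q qP] : forall t, exists q : rat, g (l t) < g (r t) ->
    g (l t) < ratr q /\ ratr q < g (r t).
  move=> t; have [lr|_] := ltP (g (l t)) (g (r t)); last by exists 0%R.
  by have [q] := rat_in_itvoo lr; rewrite in_itv /= => /andP[? ?]; exists q.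
apply/countable_injP; exists (fun t => choice.pickle (q t)) => t u.
rewrite !inE /= => -[Bt /qP[t1 t2]] [Bu /qP[u1 u2]] /(pcan_inj choice.pickleK) tu.
apply/eqP/negPn/negP => ntu; move: t1 t2; rewrite tu => t1 t2.
by have [/gm h|/gm h] := dis t u Bt Bu ntu; lra.
Qed.

Lemma essentially_countable_disjoint (B : set K) (l r : K -> K) :
  (forall t, B t -> [/\ (l t <= t)%O, (t <= r t)%O & (l t < r t)%O]) ->
  (forall t u, B t -> B u -> (t < u)%O -> (r t <= l u)%O) ->
  essentially_countable B.
Proof.
move=> Blr dis; apply: essentially_countable_intervals Blr _ => i.
apply: countable_disjoint_jumps => [s t|t u Bt Bu]; first exact: V_mono.
by case: (ltgtP t u) => // tu _; [left|right]; exact: dis.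
Qed.

(** The gap is tested against [A], but its end [s] ranges over [K], as do [s1] and [s2] in [Der]. *)
Definition left_discrete_part (A : set K) : set K :=
  [set t | A t /\ exists s, (s < t)%O /\ forall a, A a -> ~ ((s < a)%O /\ (a < t)%O)].

Definition right_discrete_part (A : set K) : set K :=
  [set t | A t /\ exists s, (t < s)%O /\ forall a, A a -> ~ ((t < a)%O /\ (a < s)%O)].

(** An earlier point of [A] cannot lie in the gap to the left of a later one, so the intervals []l
    t, t]] are pairwise disjoint. *)
Lemma left_discrete_essentially_countable (A : set K) :
  essentially_countable (left_discrete_part A).
Proof.
set B := left_discrete_part A.
have /choice[l lP] : forall t, exists l, B t ->
    (l < t)%O /\ forall a, A a -> ~ ((l < a)%O /\ (a < t)%O).
  move=> t; have [[_ [s sP]]|nB] := pselect (B t); first by exists s.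
  by exists t => /nB.
apply: (@essentially_countable_disjoint _ l id).
  by move=> t /lP[lt _]; split => //; exact: ltW.
move=> t u [At _] /lP[lu nu] tu; rewrite leNgt; apply/negP => lt.
exact: nu At (conj lt tu).
Qed.

Lemma right_discrete_essentially_countable (A : set K) :
  essentially_countable (right_discrete_part A).
Proof.
set B := right_discrete_part A.
have /choice[r rP] : forall t, exists r, B t ->
    (t < r)%O /\ forall a, A a -> ~ ((t < a)%O /\ (a < r)%O).
  move=> t; have [[_ [s sP]]|nB] := pselect (B t); first by exists s.
  by exists t => /nB.
apply: (@essentially_countable_disjoint _ id r).
  by move=> t /rP[rt _]; split => //; exact: ltW.
move=> t u /rP[tr nt] [Au _] tu; rewrite leNgt; apply/negP => ur.
exact: nt Au (conj tu ur).
Qed.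

Lemma left_isolated_essentially_countable :
  essentially_countable [set t : K | left_isolated t].
Proof.
apply: (@essentially_countableS _ ([set t | is_minK t] `|`
  left_discrete_part [set: K])).
  move=> t [mt|[s [st sP]]]; [by left|right; split => //].
  by exists s; split => // a _; exact: sP.
apply: essentially_countableU; last exact: left_discrete_essentially_countable.
apply: countable_essentially_countable.
apply: (@sub_countable _ _ _ (range (fun _ : unit => xget k0 [set t | is_minK t]))).
  apply: subset_card_le => t mt; exists tt => //; case: xgetP => [u _ mu|/(_ t)//].
  by apply/eqP; rewrite eq_le mt mu.
exact: sub_countable (card_image_le _ _) _.
Qed.

(** An internal point is not an endpoint of [K], so it can miss [Der A] only through a gap of [A] on
    one of its sides. *)
Lemma Der_layer_essentially_countable (A : set K) :
  essentially_countable (A `&` ~` Der A `&` [set t | internal t]).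
Proof.
apply: (@essentially_countableS _ (left_discrete_part A `|` right_discrete_part A)).
  move=> t /= [[At nD] [nr nl]].
  apply: contrapT => /not_orP[h1 h2]; apply: nD; split => //.
  split; first by move=> mt; apply: nl; left.
  split; first by move=> mt; apply: nr; left.
  move=> s1 s2 s1t ts2; split.
    apply: contrapT => h; apply: h1; split=> //; exists s1; split=> // a Aa [? ?].
    by apply: h; exists a.
  apply: contrapT => h; apply: h2; split=> //; exists s2; split=> // a Aa [? ?].
  by apply: h; exists a.
apply: essentially_countableU.
  exact: left_discrete_essentially_countable.
exact: right_discrete_essentially_countable.
Qed.

(** Induction on the height: [Der A] needs one derivation less, and the layer removed by it is
    already handled. *)
Lemma finite_height_essentially_countable (A : set K) : finite_two_sided_height A ->
  essentially_countable (A `&` [set t | internal t]).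
Proof.
move=> [n]; elim: n A => [|n IH] A.
  rewrite /Der_n /= => ->; rewrite set0I; exact: countable_essentially_countable.
rewrite /Der_n iterSr => /IH h.
apply: essentially_countableS (essentially_countableU (Der_layer_essentially_countable A) h).
by move=> t [At it]; have [Dt|nDt] := pselect (Der A t); [right|left].
Qed.

(** * Points with a separable adjacency *)

Section SeparableClasses.
Context (Q : set K)
  (HQ : forall H : set K, closed H -> separable_set H ->
     countable [set t | Q t /\ H t /\ ~ plus_pts H t /\ ~ c0fam (F^~ t)]).

(** The classes are convex and their closed subintervals separable, but a whole class may be
    nonseparable, as in a long ray. *)
Definition sep_related (x y : K) :=
  exists C, [/\ convex_set C, separable_set C, C x & C y].

Lemma sep_related_sym x y : sep_related x y -> sep_related y x.
Proof. by case=> C [*]; exists C. Qed.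

Lemma sep_related_trans y x z : sep_related x y -> sep_related y z -> sep_related x z.
Proof.
move=> [C [cC [D [cD [DC CD]]] Cx Cy]] [C' [cC' [D' [cD' [DC' CD']]] C'y C'z]].
exists (C `|` C'); split; [|exists (D `|` D')|by left|by right].
  move=> a b c [Ca|C'a] [Cb|C'b] ac cb.
  - by left; exact: cC ac cb.
  - have [cy|/ltW yc] := leP c y; first by left; exact: cC ac cy.
    by right; exact: cC' yc cb.
  - have [cy|/ltW yc] := leP c y; first by right; exact: cC' ac cy.
    by left; exact: cC yc cb.
  - by right; exact: cC' ac cb.
split; last split.
- rewrite -bigcup2E; apply: bigcup_countable => // n _; rewrite /bigcup2.
  by case: n => [|[|n]].
- by move=> t [/DC|/DC']; [left|right].
- by rewrite closureU => t [/CD|/CD']; [left|right].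
Qed.

Lemma sep_related_between x y z : sep_related x z ->
  (x <= y)%O -> (y <= z)%O -> sep_related x y.
Proof. by move=> [C [cC sC Cx Cz]] xy yz; exists C; split => //; exact: cC xy yz. Qed.

(** The dense set meets every nonempty open part of []x, y[]; the two endpoints, possibly isolated
    in the interval, are added by hand. *)
Lemma separable_itvcc x y : sep_related x y -> separable_set [set` `[x, y]].
Proof.
move=> [C [cC [D [cD [DC CD]]] Cx Cy]].
exists ((D `|` [set x; y]) `&` [set` `[x, y]]); split; last split.
- apply: (@sub_countable _ _ _ (D `|` [set x; y])); first by apply: subset_card_le => t [].
  rewrite -bigcup2E; apply: bigcup_countable => // n _; rewrite /bigcup2.
  case: n => [|[|n]] //=; apply: finite_set_countable; exact: finite_set2.
- by move=> t [].
- move=> t txy; have := txy; rewrite /= in_itv /= => /andP[].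
  rewrite !le_eqVlt => /orP[/eqP xt _|xt].
    by apply: subset_closure; split => //; right; left.
  move=> /orP[/eqP ty|ty].
    by apply: subset_closure; split => //; right; right.
  move=> U Ut; have Ct : C t by exact: cC (ltW xt) (ltW ty).
  have /CD/(_ (U `&` [set` `]x, y[])) [] := Ct.
    apply: filterI => //; apply: open_nbhs_nbhs; split; first exact: itv_open.
    by rewrite /= in_itv /= xt ty.
  move=> u [Du [Uu]] /=; rewrite in_itv /= => /andP[xu uy].
  by exists u; split => //; split; [left|rewrite /= in_itv /= !ltW].
Qed.

(** [HQ] applies to [[c, v]]: a point below [v] that is right-isolated there is right-isolated in
    [K], so the family is null at it. The end [v] is left out because it always belongs to
    [plus_pts]. *)
Lemma countable_separable_piece c v : sep_related c v ->
  countable [set t | [/\ Q t, ~ c0fam (F^~ t), (c <= t)%O & (t < v)%O]].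
Proof.
move=> cv; have := HQ (@itv_closed _ K c v) (separable_itvcc cv).
apply: sub_countable; apply: subset_card_le => t [Qt nt ct tv] /=.
have mem u : (c <= u)%O -> (u <= v)%O -> [set` `[c, v]] u by rewrite /= in_itv /= => -> ->.
split => //; split; first by apply: mem => //; exact: ltW.
split => //; move=> [_ [h|[s [sm [ts nts]]]]].
  have : (v <= t)%O by apply: h; apply: mem => //; exact: le_trans ct (ltW tv).
  by rewrite leNgt tv.
apply: nt; apply: right_isolated_c0; right; exists s; split => // u [tu us].
apply: (nts u) => //; apply: mem; first exact: ltW (le_lt_trans ct tu).
by move: sm; rewrite /= in_itv /= => /andP[_ sv]; exact: ltW (lt_le_trans us sv).
Qed.

(** The choice depends only on the class as a set, so related points get the same representative. *)
Definition class_rep (t : K) := xget k0 [set s | sep_related t s].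

Lemma class_repP t u : sep_related t u -> sep_related t (class_rep t).
Proof. by move=> tu; rewrite /class_rep; case: xgetP => // /(_ u). Qed.

Lemma class_rep_eq t u : sep_related t u -> class_rep t = class_rep u.
Proof.
move=> tu; rewrite /class_rep; congr (xget _ _); apply/seteqP; split=> s /=.
  exact/sep_related_trans/sep_related_sym.
exact: sep_related_trans tu.
Qed.

(* Within a class the jumps are reached by countably many of the pieces of
   [countable_separable_piece]: for [c] the representative and [q] rational, if
   [V i t < q < V i (r t)] then [t] lies below any fixed [v] of the class with
   [q < V i v]. *)
Lemma class_jumps_countable i (B : set K) (l r : K -> K) :
  (forall t, B t -> Q t /\ ~ c0fam (F^~ t)) ->
  (forall t, B t -> [/\ (l t <= t)%O, (t <= r t)%O, sep_related t (l t), sep_related t (r t) &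
     (l t = t /\ (class_rep t <= t)%O) \/ (r t = t /\ (t <= class_rep t)%O)]) ->
  countable [set t | B t /\ V i (l t) < V i (r t)].
Proof.
move=> BN Blr; set X := (X in countable X).
have /choice[tau tauP] : forall c, exists t, (class_rep @` X) c -> X t /\ class_rep t = c.
  move=> c; have [[t Xt tc]|nc] := pselect ((class_rep @` X) c); first by exists t.
  by exists c => /nc.
(* One jump [tau c] is kept per class. Overlapping intervals would merge their classes, so these
   intervals are disjoint and only countably many classes carry a jump. *)
have cX : countable (class_rep @` X).
  suff -> : class_rep @` X = [set c | (class_rep @` X) c /\ V i (l (tau c)) < V i (r (tau c))].
    apply: (@countable_disjoint_jumps (V i) _ (l \o tau) (r \o tau)); first exact: V_mono.
    suff dis c e : (class_rep @` X) c -> (class_rep @` X) e -> (tau c < tau e)%O ->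
        ((r \o tau) c <= (l \o tau) e)%O \/ c = e.
      move=> c e Xc Xe ce; have [lt|lt|tt] := ltgtP (tau c) (tau e).
      - by have [|ec] := dis c e Xc Xe lt; [left|rewrite ec eqxx in ce].
      - by have [|ec] := dis e c Xe Xc lt; [right|rewrite ec eqxx in ce].
      - have [_ h1] := tauP c Xc; have [_ h2] := tauP e Xe.
        by move: ce; rewrite -h1 -h2 tt eqxx.
    move=> Xc Xe ce.
    have [[Bc _] hc] := tauP c Xc; have [[Be _] he] := tauP e Xe.
    have [l1 r1 sl1 sr1 _] := Blr _ Bc; have [l2 r2 sl2 sr2 _] := Blr _ Be.
    have [|lt] := leP ((r \o tau) c) ((l \o tau) e); [by left|right].
    rewrite -hc -he; apply: class_rep_eq.
    have [ler|/ltW rle] := leP (r (tau c)) (tau e).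
      apply: sep_related_trans sr1 _; apply: sep_related_sym.
      have h := sep_related_sym sl2; have := sep_related_between h (ltW lt) ler.
      exact: sep_related_trans.
    exact: sep_related_between sr1 (ltW ce) rle.
  apply/seteqP; split=> [c Xc|c []] //; split => //.
  by have [[]] := tauP c Xc.
have /choice[hi hiP] : forall cq : K * rat, exists v, sep_related cq.1 cq.1 ->
    sep_related cq.1 v /\
    ((exists w, sep_related cq.1 w /\ ratr cq.2 < V i w) -> ratr cq.2 < V i v).
  move=> [c q] /=.
  have [[w [cw qw]]|nw] := pselect (exists w, sep_related c w /\ ratr q < V i w).
    by exists w.
  by exists c => cc; split=> // /nw.
have /choice[lo loP] : forall cq : K * rat, exists v, sep_related cq.1 cq.1 ->
    sep_related cq.1 v /\
    ((exists w, sep_related cq.1 w /\ V i w < ratr cq.2) -> V i v < ratr cq.2).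
  move=> [c q] /=.
  have [[w [cw qw]]|nw] := pselect (exists w, sep_related c w /\ V i w < ratr q).
    by exists w.
  by exists c => cc; split=> // /nw.
pose piece a b := [set t | [/\ Q t, ~ c0fam (F^~ t), (a <= t)%O & (t < b)%O]].
(* Points above [c] fall in [[c, hi[] and points below it in [[lo, c[]; the singleton restores [c],
   which the second piece omits. *)
apply: (@sub_countable _ _ _ (\bigcup_(c in class_rep @` X) \bigcup_(q : rat)
   ((piece c (hi (c, q)) `|` piece (lo (c, q)) c) `|` [set c]))); last first.
  apply: bigcup_countable => // c [t [Bt _] tc]; apply: bigcup_countable => // q _.
  have [_ _ tl _ _] := Blr t Bt; have := class_repP tl; rewrite tc => {}tc.
  have cc : sep_related c c by exact: sep_related_trans (sep_related_sym tc) tc.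
  have [h1 _] := hiP (c, q) cc; have [h2 _] := loP (c, q) cc.
  rewrite -!bigcup2E; apply: bigcup_countable => // n _; rewrite /bigcup2.
  case: n => [|[|n]] //=; apply: bigcup_countable => // n _.
  case: n => [|[|n]] //=; apply: countable_separable_piece => //.
  exact: sep_related_sym.
apply: subset_card_le => t Xt; have [Bt lr] := Xt; have [Qt nt] := BN t Bt.
have [_ _ tl tr lrt] := Blr t Bt.
exists (class_rep t); first by exists t.
have [q] := rat_in_itvoo lr; rewrite in_itv /= => /andP[lq qr]; exists q => //.
have tc := class_repP tl.
have cc := sep_related_trans (sep_related_sym tc) tc.
have [_ h1] := hiP (class_rep t, q) cc; have [_ h2] := loP (class_rep t, q) cc.
case: lrt => [[lt ct]|[rt]].
  left; left; split => //; rewrite ltNge; apply/negP => /(V_mono i).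
  have : (ratr q : R) < V i (hi (class_rep t, q)).
    apply: h1; exists (r t); split=> //=; exact: sep_related_trans (sep_related_sym tc) tr.
  rewrite lt in lq => a b; have := lt_le_trans (lt_trans lq a) b; by rewrite ltxx.
rewrite le_eqVlt => /orP[/eqP tE|tc']; first by right.
left; right; split => //; rewrite leNgt; apply/negP => /ltW/(V_mono i).
have : V i (lo (class_rep t, q)) < (ratr q : R).
  apply: h2; exists (l t); split=> //=; exact: sep_related_trans (sep_related_sym tc) tl.
rewrite rt in qr => a b; have := lt_le_trans (lt_trans a qr) b; by rewrite ltxx.
Qed.

(** Each point gets an interval inside its class, on the side away from the representative, as
    [class_jumps_countable] requires. This fails only at an endpoint of the class; there the
    interval runs back to the representative, and one such endpoint per side and class makes these
    intervals disjoint. *)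
Lemma adjacent_essentially_countable :
  essentially_countable [set t | [/\ Q t, ~ c0fam (F^~ t) & separable_adjacency t]].
Proof.
pose ismax := [set t |
  [/\ sep_related t t, (class_rep t < t)%O & ~ exists s, (t < s)%O /\ sep_related t s]].
pose ismin := [set t |
  [/\ sep_related t t, (t < class_rep t)%O & ~ exists s, (s < t)%O /\ sep_related t s]].
pose rest := [set t | [/\ Q t, ~ c0fam (F^~ t) & exists lr : K * K,
  [/\ (lr.1 < lr.2)%O, (lr.1 <= t)%O, (t <= lr.2)%O, sep_related t lr.1 /\ sep_related t lr.2 &
     (lr.1 = t /\ (class_rep t <= t)%O) \/ (lr.2 = t /\ (t <= class_rep t)%O)]]].
apply: (@essentially_countableS _ (ismax `|` ismin `|` rest)).
  move=> t [Qt nt [C [cC [sC [Ct [x [y [Cx [Cy xy]]]]]]]]].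
  have tt : sep_related t t by exists C.
  have [z [tz Cz]] : exists z, t != z /\ C z.
    have [tx|tx] := eqVneq t x; last by exists x.
    by exists y; split=> //; rewrite tx; apply/eqP.
  have stz : sep_related t z by exists C.
  have Rr s : (t < s)%O -> sep_related t s -> (class_rep t <= t)%O -> rest t.
    by move=> ts sts ct; split=> //; exists (t, s); split=> //=; [exact: ltW|left].
  have Rl s : (s < t)%O -> sep_related t s -> (t <= class_rep t)%O -> rest t.
    by move=> ts sts ct; split=> //; exists (s, t); split=> //=; [exact: ltW|right].
  have [lt|lt|e] := ltgtP t (class_rep t).
  - have [[s [st sts]]|h] := pselect (exists s, (s < t)%O /\ sep_related t s).
      by right; exact: Rl st sts (ltW lt).
    by left; right.
  - have [[s [st sts]]|h] := pselect (exists s, (t < s)%O /\ sep_related t s).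
      by right; exact: Rr st sts (ltW lt).
    by left; left.
  - right; have [lz|lz|ez] := ltgtP t z; last by rewrite ez eqxx in tz.
      by apply: Rr lz stz _; rewrite -e.
    by apply: Rl lz stz _; rewrite -e.
apply: essentially_countableU; first apply: essentially_countableU.
- apply: (@essentially_countable_disjoint _ class_rep id).
    by move=> t [_ ct _]; split=> //; exact: ltW.
  move=> t u [tt _ nt] [uu cu _] tu; rewrite leNgt; apply/negP => ct.
  apply: nt; exists u; split=> //.
  have h := sep_related_sym (class_repP uu).
  exact: sep_related_trans (sep_related_sym (sep_related_between h (ltW ct) (ltW tu))) h.
- apply: (@essentially_countable_disjoint _ id class_rep).
    by move=> t [_ ct _]; split=> //; exact: ltW.
  move=> t u [tt ct _] [uu _ nu] tu; rewrite leNgt; apply/negP => uc.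
  apply: nu; exists t; split=> //.
  apply: sep_related_sym; exact: sep_related_between (class_repP tt) (ltW tu) (ltW uc).
have /choice[lr lrP] : forall t, exists lr : K * K, rest t ->
   [/\ (lr.1 < lr.2)%O, (lr.1 <= t)%O, (t <= lr.2)%O, sep_related t lr.1 /\ sep_related t lr.2 &
     (lr.1 = t /\ (class_rep t <= t)%O) \/ (lr.2 = t /\ (t <= class_rep t)%O)].
  move=> t; have [[Qt nt [lr lrP]]|nr] := pselect (rest t); first by exists lr.
  by exists (t, t) => /nr.
apply: (@essentially_countable_intervals _ (fst \o lr) (snd \o lr)).
  by move=> t /lrP[].
move=> i; apply: class_jumps_countable; first by move=> t [].
by move=> t /lrP[? ? ? [? ?] ?].
Qed.
End SeparableClasses.

Lemma max_in_seq (c : K -> nat) (S : seq K) t0 : t0 \in S ->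
  exists t, t \in S /\ forall u, u \in S -> (c u <= c t)%N.
Proof.
elim: S t0 => // x S IH t0 _; have [->|] := eqVneq S [::].
  by exists x; rewrite mem_head; split=> // u; rewrite inE => /eqP->.
case: S IH => // y S IH _; have [t [tS ht]] := IH y (mem_head _ _).
have [tx|xt] := leqP (c t) (c x).
  exists x; rewrite mem_head; split=> // u; rewrite inE => /orP[/eqP->//|/ht ut].
  exact: leq_trans ut tx.
exists t; rewrite inE tS orbT; split=> // u; rewrite inE => /orP[/eqP->|/ht//].
exact: ltnW.
Qed.

Lemma ler_sum_uniq_sub (a : K -> R) (S L : seq K) : uniq S -> uniq L ->
  {subset S <= L} -> (forall t, 0 <= a t) -> \sum_(t <- S) a t <= \sum_(t <- L) a t.
Proof.
move=> uS uL SL a0.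
have pS : perm_eq S [seq x <- L | x \in S].
  apply: uniq_perm => //; first exact: filter_uniq.
  by move=> x; rewrite mem_filter; case: (boolP (x \in S)) => // /SL ->.
rewrite (perm_big _ pS) big_filter big_mkcond /=.
by apply: ler_sum => t _; case: ifP.
Qed.

(** * Countable components and the summable part *)

Section Linking.
Context (N : set K) (S : I -> set K).
Context (cS : forall i, countable (S i))
  (NF : forall t, N t -> countable [set i | F i t != 0]).

Definition adj i t := [/\ N t, S i t & F i t != 0].

Definition link t u := exists i, adj i t /\ adj i u.

(** Length zero is equality, so [t] lies in its own component even when no index is adjacent to
    it. *)
Fixpoint reach n t u := if n is m.+1 then exists2 v, reach m t v & link v u else t = u.

Definition component t : set K := [set u | exists n, reach n t u].

Lemma reach_trans m n t u v : reach n t u -> reach m u v -> reach (m + n) t v.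
Proof.
move=> tu; elim: m v => [|m IH] v /=; first by move=> <-.
by move=> [w uw wv]; exists w => //; exact: IH.
Qed.

Lemma reach_sym n t u : reach n t u -> reach n u t.
Proof.
elim: n t u => [|n IH] t u //= [v tv [i [iv iu]]].
have uv : reach 1 u v by exists u => //; exists i.
by have := reach_trans uv (IH _ _ tv); rewrite addn1.
Qed.

Lemma component_eq t u : component t u -> component t = component u.
Proof.
move=> [n tu]; apply/seteqP; split=> v [m h].
  by exists (m + n)%N; exact: reach_trans (reach_sym tu) h.
by exists (m + n)%N; exact: reach_trans tu h.
Qed.

Lemma component_sub t : N t -> component t `<=` N.
Proof. by move=> Nt u [[|n] /= tu]; [rewrite -tu|case: tu => v _ [i [_ []]]]. Qed.

Lemma countable_component t : N t -> countable (component t).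
Proof.
move=> Nt; have -> : component t = \bigcup_n [set u | reach n t u].
  by apply/seteqP; split=> [u [n h]|u [n _ h]]; exists n.
apply: bigcup_countable => // n _; elim: n => [|n IH].
  by apply: sub_countable (countable1 t); apply: subset_card_le => u /= ->.
apply: (@sub_countable _ _ _
    (\bigcup_(v in [set u | reach n t u]) \bigcup_(i in [set i | F i v != 0]) S i)).
  by apply: subset_card_le => u [v tv [i [[_ _ iv] [_ iu _]]]]; exists v => //; exists i.
apply: bigcup_countable => // v tv; apply: bigcup_countable => [|i _]; last exact: cS.
by apply: NF; apply: component_sub Nt _ _; exists n.
Qed.
End Linking.

(** The list [L t] depends on [t] alone, so [finite_sum_bound] discards finitely many [i] for each
    [t]. For a fixed [i], the member of [X] enumerated last has all of [X] in its list, so the bound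
    on that one list suffices. *)
Lemma essentially_countable_summable (N : set K) :
  (forall t, N t -> ~ right_isolated t) ->
  (forall t, N t -> countable [set i | F i t != 0]) ->
  essentially_countable N ->
  exists (E : I -> set K) (M : R), [/\ 0 <= M,
    forall t, N t -> forall e, 0 < e -> finite_set [set i | ~ E i t /\ e <= `|F i t|] &
    forall i (X : seq K), uniq X -> (forall t, t \in X -> E i t) -> \sum_(t <- X) `|F i t| <= M].
Proof.
move=> NR NF [S [cS SN]]; have [M [M0 hM]] := uniform_bound.
(* The enumeration is attached to the component as a set, so linked points share it. *)
have /choice[code codeP] : forall A : set K, exists c : K -> nat,
    countable A -> {in A &, injective c}.
  move=> A; have [/countable_injP[c hc]|nA] := pselect (countable A); first by exists c.
  by exists (fun=> 0%N).
pose comp t := component N S t; pose c t := code (comp t).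
have /choice[L LP] : forall t, exists L : seq K, N t ->
    uniq L /\ [set` L] = [set u | comp t u /\ (c t u <= c t t)%N].
  move=> t; have [Nt|nN] := pselect (N t); last by exists [::].
  have /finite_seqP[L LE] : finite_set [set u | comp t u /\ (c t u <= c t t)%N].
    have cinj := codeP _ (countable_component cS NF Nt).
    set A := (X in finite_set X).
    have cA : {in A &, injective (c t)}.
      by move=> u v; rewrite !inE => -[? _] [? _]; apply: cinj; rewrite inE.
    rewrite -(eq_finite_set (inj_card_eq cA)).
    by apply: (@sub_finite_set _ _ `I_(c t t).+1) => // _ [u [_ ut] <-].
  exists (undup L) => _; split; first exact: undup_uniq.
  by rewrite LE; apply/seteqP; split=> u /=; rewrite mem_undup.
pose E i := [set t | adj N S i t /\ \sum_(u <- L t) `|F i u| <= M + 1].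
exists E, (M + 1); split; first by rewrite addr_ge0.
- move=> t Nt e e0; have [uL LE] := LP t Nt.
  have LN u : u \in L t -> N u.
    move=> uL'; have : [set` L t] u by [].
    by rewrite LE => -[+ _]; exact: component_sub.
  have fin : finite_set [set i | M + 1 < \sum_(u <- L t) `|F i u|].
    by apply: finite_sum_bound => // u /LN; exact: NR.
  have := SN t Nt e e0; move=> fin'.
  apply: (@sub_finite_set _ _ ([set i | ~ S i t /\ e <= `|F i t|] `|`
     [set i | M + 1 < \sum_(u <- L t) `|F i u|])); last by rewrite finite_setU.
  move=> i /= [nE eF]; have [Sit|nS] := pselect (S i t); last by left.
  right; rewrite ltNge; apply/negP => le; apply: nE; split => //; split => //.
  by rewrite -normr_gt0; exact: lt_le_trans eF.
- move=> i X uX XE; case: X uX XE => [|t0 X] uX XE; first by rewrite big_nil addr_ge0.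
  (* Points adjacent to the same [i] are one link apart. *)
  have ct u v : u \in t0 :: X -> v \in t0 :: X -> comp u v.
    by move=> /XE[iu _] /XE[iv _]; exists 1%N; exists u => //; exists i.
  have [t [tX tmax]] := max_in_seq (c t0) (mem_head t0 X).
  have [[Nt _ _] le] := XE t tX; have [uL LE] := LP t Nt.
  apply: le_trans (ler_sum_uniq_sub (a := fun u => `|F i u|) uX uL _ _) le => // u uX'.
  suff : [set` L t] u by [].
  rewrite LE; split; first exact: ct.
  have -> : c t = c t0 by rewrite /c; congr code; apply: component_eq; exact: ct (mem_head _ _).
  exact: tmax.
Qed.

Lemma summable_type_c0l1 (Q N : set K) (E : I -> set K) (M : R) : 0 <= M ->
  (forall t, Q t -> ~ N t -> c0fam (F^~ t)) ->
  (forall t, N t -> forall e, 0 < e -> finite_set [set i | ~ E i t /\ e <= `|F i t|]) ->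
  (forall i (X : seq K), uniq X -> (forall t, t \in X -> E i t) -> \sum_(t <- X) `|F i t| <= M) ->
  type_c0l1 F Q.
Proof.
move=> M0 QN NE EM; pose b i t := if `[< E i t >] then F i t else 0.
exists (fun i t => F i t - b i t), b; split; [by move=> i t _; rewrite subrK|split].
  move=> t Qt e e0; have [Nt|nN] := pselect (N t).
    apply: sub_finite_set (NE t Nt e e0) => i /=; rewrite /b; case: asboolP => // nE.
      by rewrite subrr normr0 leNgt e0.
    by rewrite subr0.
  apply: sub_finite_set (QN t Qt nN e e0) => i /=; rewrite /b; case: asboolP => // _.
    by rewrite subrr normr0 leNgt e0.
  by rewrite subr0.
(* The extended sum is a supremum over finite subsets; each is turned into a duplicate-free list and
   cut down to [E i], where [b] is nonzero. *)
exists M => i; apply: ub_ereal_sup => _ [X [/finite_seqP[s sX] _] <-].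
have -> : X = [set` undup s] by rewrite sX; apply/seteqP; split=> u /=; rewrite mem_undup.
rewrite -fsbig_seq ?undup_uniq // sumEFin lee_fin.
rewrite (_ : \sum_(_ <- _) _ = \sum_(t <- [seq t <- undup s | `[< E i t >]]) `|F i t|).
  apply: EM; first by rewrite filter_uniq ?undup_uniq.
  by move=> t; rewrite mem_filter => /andP[/asboolP].
rewrite big_filter [RHS]big_mkcond; apply: eq_bigr => t _; rewrite /b.
by case: ifP; rewrite ?normr0.
Qed.

Lemma tail_system_separably_determined (Q : set K) :
  (forall H : set K, closed H -> separable_set H ->
     countable [set t | Q t /\ H t /\ ~ plus_pts H t /\ ~ c0fam (F^~ t)]) ->
  (exists A : nat -> set K, (forall n, finite_two_sided_height (A n)) /\
     [set t | internal t /\ countable_right_char t /\ ~ separable_adjacency t]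
       `<=` \bigcup_n A n) ->
  type_c0l1 F Q.
Proof.
move=> HQ [A [hA cover]]; pose N := [set t | Q t /\ ~ c0fam (F^~ t)].
have NR t : N t -> ~ right_isolated t by move=> [_ nt] /right_isolated_c0.
have Nc t : N t -> countable_right_char t by move=> [_ /not_c0_countable_right_char].
have ecN : essentially_countable N.
  (* A point of [N] that is not left-isolated is internal, since [NR] excludes right isolation;
     without a separable adjacency it then falls under the cover. *)
  apply: (@essentially_countableS _ ([set t | left_isolated t] `|`
     [set t | [/\ Q t, ~ c0fam (F^~ t) & separable_adjacency t]] `|`
     \bigcup_n (A n `&` [set t | internal t]))).
    move=> t Nt; have [lt|nl] := pselect (left_isolated t); first by left; left.
    have [at_|na] := pselect (separable_adjacency t); first by left; right; case: Nt.
    have it : internal t by split => //; exact: NR.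
    right; have [|n _ An] := cover t; first by split=> //; split => //; exact: Nc.
    by exists n.
  apply: essentially_countableU; first apply: essentially_countableU.
  - exact: left_isolated_essentially_countable.
  - exact: adjacent_essentially_countable.
  - by apply: essentially_countable_bigcup => n; exact: finite_height_essentially_countable.
have NF t : N t -> countable [set i | F i t != 0].
  by move=> Nt; apply: countable_right_char_support; [exact: NR|exact: Nc].
have [E [M [M0 NE EM]]] := essentially_countable_summable NR NF ecN.
apply: summable_type_c0l1 M0 _ NE EM => t Qt nN.
by apply: contrapT => nt; apply: nN.
Qed.
End TailSystems.

(** * Application to signed Radon measures *)

Theorem theorem3p7 (d : Order.disp_t) (K : orderTopologicalType d) (R : realType) :
  compact_line K ->
  (exists A : nat -> set K,
     (forall n, finite_two_sided_height (A n)) /\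
     [set t | internal t /\ countable_right_char t /\ ~ separable_adjacency t]
       `<=` \bigcup_n A n) ->
  separably_determined K R.
Proof.
move=> cK cover k0 I mp mn rmu null Q HQ.
(* The dominating [V i] is the distribution function of [mp i + mn i]. *)
apply: (@tail_system_separably_determined _ K R I cK k0 (fun i => pairing (mp i) (mn i))
  (fun i => Fmu (mp i) (mn i)) (fun i t => distr (mp i) t + distr (mn i) t)) => //.
- by move=> i f g c; exact: pairing_linear.
- move=> i; exists (fine (mp i setT) + fine (mn i setT)) => f e; exact: pairing_bound.
- by move=> i f l r t; exact: Fmu_ramp.
- by move=> i f s t; exact: Fmu_jump.
- by move=> i t; exact: Fmu_max.
- by move=> i s t st; apply: lerD; exact: le_distr.
(* Half of [e] goes to each of the two measures; by monotonicity the smaller of the two points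
   serves both. *)
- move=> i t e nt e0; have [rp rn] := rmu i; have e2 : 0 < e / 2 by rewrite divr_gt0.
  have [s1 [ts1 h1]] := radon_distr_right rp nt e2.
  have [s2 [ts2 h2]] := radon_distr_right rn nt e2.
  exists (Order.min s1 s2); rewrite lt_min ts1 ts2; split=> //.
  have := @le_distr _ K k0 R (mp i) (Order.min s1 s2) s1; rewrite ge_min lexx => /(_ isT).
  have := @le_distr _ K k0 R (mn i) (Order.min s1 s2) s2; rewrite ge_min lexx orbT => /(_ isT).
  lra.
Qed.
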